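(* Let $H$ be a strictly balanced graph, $c>0$, $h_0>0$, with $\mu:=c^{v(H)}/|\mathrm{Aut}(H)|\ge h_0$. Let $m_n\to\infty$ and, for each $n$, let $\mathcal{G}_{n,1},\dots,\mathcal{G}_{n,n}$ be i.i.d. $G\big(m_n,(c/m_n)^{1/k(H)}\big)$ graphs, with $h_{n,i}=\mathcal{T}(H,\mathcal{G}_{n,i})-h_0$. Let $\hat\lambda_n$ be the unique real root of $\sum_{i=1}^n h_{n,i}e^{-\lambda h_{n,i}}=0$ (defined on an event of probability tending to one). Then $\hat\lambda_n\xrightarrow{P}\lambda^{\circ}:=\log(\mu/h_0)$.
   Context: $v(H),e(H)$ are the numbers of vertices and edges of $H$; $k(H)=\max\{e(F)/v(F): F\subseteq H,\ e(F)\ge1\}$; $H$ is strictly balanced if $e(H)/v(H)>e(F)/v(F)$ for every proper subgraph $F$ with at least one edge. $\mathcal{T}(H,G)=\mathrm{inj}(H,G)/|\mathrm{Aut}(H)|$ is the number of unlabelled copies of $H$ in $G$ ($\mathrm{inj}$ counts injective edge-preserving maps, $\mathrm{Aut}(H)$ the automorphism group). $G(m,p)$ is the Erdős–Rényi random graph. *)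

(* Defs.v *)
From HB Require Import structures.
From mathcomp Require Import all_boot all_order all_algebra.
From mathcomp Require Import all_classical all_reals all_analysis.
From mathcomp Require Import fingroup perm.
Set Implicit Arguments. Unset Strict Implicit. Unset Printing Implicit Defensive.
Import Order.TTheory GRing.Theory Num.Theory.
Local Open Scope ring_scope.

(* A finite simple graph on vertex type V is given by its edge set:
   a set of 2-element subsets of V. Its vertex set is all of V. *)
Definition is_graph (V : finType) (E : {set {set V}}) : bool :=
  [forall e in E, #|e| == 2%N].

Definition is_subgraph (V : finType) (E : {set {set V}})
    (S : {set V}) (F : {set {set V}}) : bool :=
  (F \subset E) && [forall e in F, e \subset S].

Definition vH (V : finType) : nat := #|V|.
Definition eH (V : finType) (E : {set {set V}}) : nat := #|E|.

Definition density (S : nat) (F : nat) : rat := (F%:R / S%:R)%R.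

Definition strictly_balanced (V : finType) (E : {set {set V}}) : Prop :=
  forall (S : {set V}) (F : {set {set V}}),
    is_subgraph E S F -> (1 <= #|F|)%N -> (S, F) != ([set: V], E) ->
    density #|S| #|F| < density #|V| #|E|.

Definition kH (V : finType) (E : {set {set V}}) : rat :=
  \big[Num.max/0]_(SF : {set V} * {set {set V}}
                   | is_subgraph E SF.1 SF.2 && (1 <= #|SF.2|)%N)
     density #|SF.1| #|SF.2|.

Definition autH (V : finType) (E : {set {set V}}) : nat :=
  #|[set s : {perm V} | [forall e : {set V}, (e \in E) == ((s @: e) \in E)]]|.

Definition injHG (V : finType) (E : {set {set V}}) (m : nat)
    (G : {set {set 'I_m}}) : nat :=
  #|[set f : {ffun V -> 'I_m} | injectiveb f && [forall e in E, (f @: e) \in G]]|.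

Definition copies (R : realType) (V : finType) (E : {set {set V}}) (m : nat)
    (G : {set {set 'I_m}}) : R :=
  (injHG E G)%:R / (autH E)%:R.

Definition gnp_mass (R : realType) (m : nat) (p : R) (G : {set {set 'I_m}}) : R :=
  if is_graph G then p ^+ #|G| * (1 - p) ^+ ('C(m, 2) - #|G|) else 0.

Definition iid_gnp_prob (R : realType) (n m : nat) (p : R)
    (A : {ffun 'I_n -> {set {set 'I_m}}} -> Prop) : R :=
  \sum_(w : {ffun 'I_n -> {set {set 'I_m}}} | `[< A w >])
     \prod_(i < n) gnp_mass p (w i).

Definition est_fun (R : realType) (n : nat) (h : 'I_n -> R) (lam : R) : R :=
  \sum_(i < n) h i * expR (- (lam * h i)).

(* Main.v *)
Require Import Defs.
From HB Require Import structures.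
From mathcomp Require Import all_boot all_order all_algebra.
From mathcomp Require Import all_classical all_reals all_analysis.
From mathcomp Require Import finset fingroup perm.
From mathcomp Require Import ring lra zify.
Set Implicit Arguments. Unset Strict Implicit. Unset Printing Implicit Defensive.
Import Order.TTheory GRing.Theory Num.Theory.
Import numFieldNormedType.Exports.
Local Open Scope ring_scope.

(** No Poisson limit theorem is needed.  Planting a copy of H in G(m,p) raises the number T
    of copies by 1, up to the copies that overlap the planted one, and strict balance makes
    the expected number of these tend to 0.  This gives the approximate Stein-Chen identity
    E[T g(T)] = mu E[g(T+1)] + o(1) for Lipschitz g.  With g(t) = exp(-l t), l >= 0, it reads
    E[(T - h0) exp(-l T)] = (mu exp(-l) - h0) E[exp(-l T)] + o(1), whose sign is that of
    log(mu/h0) - l.  Chebyshev's inequality then fixes the sign of the strictly decreasing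
    estimating function at log(mu/h0) - eps and log(mu/h0) + eps, so its root lies between.
    When mu = h0 the left point is negative and the weight exp(-l t) is unbounded; there
    the summand is bounded below by one to which the argument applies. *)

(** * Expectation over the binomial random graph *)

Definition expect (R : realType) (m : nat) (p : R)
    (phi : {set {set 'I_m}} -> R) : R :=
  \sum_G gnp_mass p G * phi G.

(** Every subset of ['I_m] gets a factor, not only the pairs: a non-pair contributes 0 when present
    and 1 when absent, so non-graphs get mass 0. In this form, sums over [G] factor by
    distributivity. *)
Lemma gnp_massE (R : realType) (m : nat) (p : R) (G : {set {set 'I_m}}) :
  gnp_mass p G = \prod_e (if e \in G then (if #|e| == 2%N then p else 0)
                          else (if #|e| == 2%N then 1 - p else 1)).
Proof.
rewrite /gnp_mass (bigID (mem G)) /=.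
rewrite (eq_bigr (fun e : {set 'I_m} => if #|e| == 2%N then p else 0)); last first.
  by move=> e ->.
rewrite (eq_bigr (fun e : {set 'I_m} => if #|e| == 2%N then 1 - p else 1)
  (P := fun e => e \notin G)); last first.
  by move=> e /negbTE ->.
case: ifPn => [/forallP gG|/forallPn[e]].
  rewrite (eq_bigr (fun=> p)); last first.
    by move=> e eG; have := gG e; rewrite eG /= => ->.
  rewrite prodr_const -big_mkcondr /= prodr_const; congr (_ * _ ^+ _).
  rewrite -[X in 'C(X, 2)]card_ord -(card_draws 'I_m 2) -(cardsID G).
  have -> : [set A : {set 'I_m} | #|A| == 2%N] :&: G = G.
    apply/setP => e; rewrite !inE andbC; case eG: (e \in G) => //=.
    by have := gG e; rewrite eG.
  rewrite addKn; apply: eq_card => e.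
  by rewrite !inE.
rewrite negb_imply => /andP[eG /negbTE e2].
by rewrite (bigD1 e) //= e2 !mul0r.
Qed.

Lemma gnp_mass_ge0 (R : realType) (m : nat) (p : R) (G : {set {set 'I_m}}) :
  0 <= p <= 1 -> 0 <= gnp_mass p G.
Proof.
case/andP=> p0 p1; rewrite gnp_massE; apply: prodr_ge0 => e _.
by do 2!case: ifP => //; rewrite subr_ge0.
Qed.

Lemma sum_gnp_mass (R : realType) (m : nat) (p : R) :
  \sum_(G : {set {set 'I_m}}) gnp_mass p G = 1.
Proof.
under eq_bigr do rewrite gnp_massE.
rewrite -bigA_distr big1 // => e _.
by case: ifP => _ /=; ring.
Qed.

Lemma expect_cst (R : realType) (m : nat) (p k : R) :
  expect (m := m) p (fun=> k) = k.
Proof. by rewrite /expect -big_distrl /= sum_gnp_mass mul1r. Qed.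

Lemma expectD (R : realType) (m : nat) (p : R) (f g : {set {set 'I_m}} -> R) :
  expect p (fun G => f G + g G) = expect p f + expect p g.
Proof. by rewrite /expect -big_split; apply: eq_bigr => G _; rewrite mulrDr. Qed.

Lemma expectZ (R : realType) (m : nat) (p k : R) (f : {set {set 'I_m}} -> R) :
  expect p (fun G => k * f G) = k * expect p f.
Proof. by rewrite /expect big_distrr; apply: eq_bigr => G _; rewrite /= mulrCA. Qed.

Lemma expectB (R : realType) (m : nat) (p : R) (f g : {set {set 'I_m}} -> R) :
  expect p (fun G => f G - g G) = expect p f - expect p g.
Proof. by rewrite /expect -sumrB; apply: eq_bigr => G _; rewrite mulrBr. Qed.

Lemma expect_sum (R : realType) (m : nat) (p : R) (I : finType) (P : pred I)
    (f : I -> {set {set 'I_m}} -> R) :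
  expect p (fun G => \sum_(i | P i) f i G) = \sum_(i | P i) expect p (f i).
Proof.
rewrite /expect exchange_big; apply: eq_bigr => G _.
by rewrite big_distrr.
Qed.

Lemma eq_expect (R : realType) (m : nat) (p : R) (f g : {set {set 'I_m}} -> R) :
  f =1 g -> expect p f = expect p g.
Proof. by move=> fg; apply: eq_bigr => G _; rewrite fg. Qed.

Lemma ler_expect (R : realType) (m : nat) (p : R) (f g : {set {set 'I_m}} -> R) :
  0 <= p <= 1 -> (forall G, f G <= g G) -> expect p f <= expect p g.
Proof.
move=> p01 fg; apply: ler_sum => G _.
by rewrite ler_wpM2l ?gnp_mass_ge0.
Qed.

Lemma ler_norm_expect (R : realType) (m : nat) (p : R) (f : {set {set 'I_m}} -> R) :
  0 <= p <= 1 -> `|expect p f| <= expect p (fun G => `|f G|).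
Proof.
move=> p01; apply: le_trans (ler_norm_sum _ _ _) _; apply: ler_sum => G _.
by rewrite normrM (ger0_norm (gnp_mass_ge0 _ p01)).
Qed.

(** Toggling [e] pairs the sets with and without [e]; [p] times the joint mass of a pair is the mass
    of its member containing [e]. *)
Lemma expect_edge (R : realType) (m : nat) (p : R) (e : {set 'I_m})
    (phi : {set {set 'I_m}} -> R) : #|e| == 2%N ->
  expect p (fun G => (e \in G)%:R * phi G) = p * expect p (fun G => phi (e |: G)).
Proof.
move=> e2; rewrite /expect [LHS](bigID (fun G : {set {set 'I_m}} => e \in G)).
rewrite [X in _ = _ * X](bigID (fun G : {set {set 'I_m}} => e \in G)) /=.
rewrite [X in _ + X]big1 ?addr0; last by move=> G /negbTE ->; rewrite mul0r mulr0.
rewrite [X in _ = _ * (_ + X)](reindex_onto (fun G : {set {set 'I_m}} => G :\ e)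
  (fun G => e |: G)) /=; last by move=> G eG; rewrite setU1K.
rewrite [X in _ = _ * (_ + X)](eq_bigl (fun G : {set {set 'I_m}} => e \in G)); last first.
  move=> G; rewrite setD11 /=; apply/eqP/idP => [<-|eG]; first exact: setU11.
  exact: setD1K.
rewrite -big_split /= big_distrr /=; apply: eq_bigr => G eG.
rewrite eG mul1r setD1K // setUC (setUidPl _) ?sub1set //.
suff {1}-> : gnp_mass p G = p * (gnp_mass p G + gnp_mass p (G :\ e)) by ring.
rewrite !gnp_massE (bigD1 e) //= [in X in _ = _ * (_ + X)](bigD1 e) //= eG setD11 e2.
rewrite (eq_bigr (fun e0 : {set 'I_m} => if e0 \in G then if #|e0| == 2%N then p else 0
     else if #|e0| == 2%N then 1 - p else 1) (P := fun e0 => e0 != e) (F1 :=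
  fun i : {set 'I_m} => if i \in G :\ e then _ else _)); first by ring.
by move=> f fe; rewrite !inE fe.
Qed.

(** Planting: restricting to the event that [A] is present costs [p ^+ #|A|] and leaves the other
    edges untouched. The edges of [A] are inserted one at a time. *)
Lemma expect_sub (R : realType) (m : nat) (p : R) (A : {set {set 'I_m}})
    (phi : {set {set 'I_m}} -> R) : is_graph A ->
  expect p (fun G => (A \subset G)%:R * phi G)
  = p ^+ #|A| * expect p (fun G => phi (A :|: G)).
Proof.
move: {2}#|A| (erefl #|A|) => k; elim: k A phi => [|k IH] A phi Ak gA.
  move/eqP: Ak; rewrite cards_eq0 => /eqP ->.
  rewrite cards0 expr0 mul1r; apply: eq_expect => G.
  by rewrite sub0set mul1r set0U.
have /set0Pn[e eA] : A != set0 by rewrite -cards_eq0 Ak.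
have Ae : #|A :\ e| = k by move: (cardsD1 e A); rewrite eA Ak add1n => -[].
have gAe : is_graph (A :\ e).
  apply/forallP => f; apply/implyP; rewrite inE => /andP[_ fA].
  by move/forallP: gA => /(_ f); rewrite fA.
have e2 : #|e| == 2%N by move/forallP: gA => /(_ e); rewrite eA.
transitivity (expect p (fun G => (A :\ e \subset G)%:R * ((e \in G)%:R * phi G))).
  apply: eq_expect => G; rewrite -{1}(setD1K eA) subUset sub1set andbC.
  by rewrite mulrA -natrM mulnb.
rewrite (IH _ (fun G => (e \in G)%:R * phi G)) // Ae Ak exprSr -mulrA; congr (_ * _).
transitivity (expect p (fun G => (e \in G)%:R * phi (A :\ e :|: G))).
  by apply: eq_expect => G; rewrite !inE eqxx.
rewrite (expect_edge p (fun G => phi (A :\ e :|: G))) //; congr (_ * _).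
by apply: eq_expect => G; rewrite setUCA setUA setD1K.
Qed.

Lemma prob_sub (R : realType) (m : nat) (p : R) (A : {set {set 'I_m}}) :
  is_graph A -> expect p (fun G => (A \subset G)%:R) = p ^+ #|A|.
Proof.
move=> gA; have := expect_sub p (fun=> 1) gA; rewrite expect_cst mulr1 => <-.
by apply: eq_expect => G; rewrite mulr1.
Qed.

(** * Embeddings of H and their overlaps *)

Lemma is_graphP (W : finType) (G : {set {set W}}) :
  reflect (forall e, e \in G -> #|e| = 2%N) (is_graph G).
Proof.
apply: (iffP forallP) => [gG e eG|gG e]; last by apply/implyP => /gG ->.
by move: (gG e); rewrite eG => /eqP.
Qed.

Definition edge_image (V : finType) (m : nat) (E : {set {set V}})
    (f : {ffun V -> 'I_m}) : {set {set 'I_m}} :=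
  [set f @: (e : {set V}) | e : {set V} in E].

Section EdgeImage.
Context (V : finType) (m : nat) (E : {set {set V}}).
Implicit Types f g : {ffun V -> 'I_m}.

Lemma imset_injective f : injective f -> injective (fun e : {set V} => f @: e).
Proof.
move=> fi A B /setP AB; apply/setP => x.
by have := AB (f x); rewrite !mem_imset.
Qed.

Lemma mem_edge_image f (e : {set V}) : injective f -> (f @: e \in edge_image E f) = (e \in E).
Proof. by move=> fi; rewrite mem_imset //; exact: imset_injective. Qed.

Lemma card_edge_image f : injective f -> #|edge_image E f| = #|E|.
Proof. by move=> fi; rewrite card_imset //; exact: imset_injective. Qed.

Lemma is_graph_edge_image f : is_graph E -> injective f -> is_graph (edge_image E f).
Proof.
move=> /is_graphP gE fi; apply/is_graphP => _ /imsetP[e eE ->].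
by rewrite card_imset // gE.
Qed.

Lemma injHGE (R : realType) (G : {set {set 'I_m}}) :
  (injHG E G)%:R = \sum_(f : {ffun V -> 'I_m} | injectiveb f)
                      (edge_image E f \subset G)%:R :> R.
Proof.
rewrite -natr_sum -big_mkcondr sum1dep_card /=; congr (_%:R).
apply: eq_card => f; rewrite !inE; congr (_ && _).
apply/forallP/fintype.subsetP => [fE _ /imsetP[e eE ->]|fE e].
  by move: (fE e); rewrite eE.
by apply/implyP => eE; apply: fE; apply: imset_f.
Qed.

(** As [H] has no isolated vertex, the edge image determines the range. So [g] factors as [f] after
    a permutation of [V], which must preserve [E]; hence each copy of [H] comes from exactly
    [autH E] embeddings. *)
Lemma card_same_edge_image f : (forall x, exists2 e, e \in E & x \in e) ->
  injective f ->
  #|[set g : {ffun V -> 'I_m} | injectiveb g && (edge_image E g == edge_image E f)]|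
  = autH E.
Proof.
move=> cov fi; rewrite /autH.
pose h (s : {perm V}) : {ffun V -> 'I_m} := [ffun x => f (s x)].
have hi : injective h.
  move=> s t /ffunP st; apply/permP => x; apply: fi.
  by have := st x; rewrite !ffunE.
have hE (s : {perm V}) (e : {set V}) : h s @: e = f @: (s @: e).
  by rewrite -imset_comp; apply: eq_imset => x; rewrite ffunE.
rewrite -(card_imset _ hi); apply: eq_card => g; rewrite !inE.
apply/andP/imsetP => [[/injectiveP gi /eqP gE]|[s + ->]].
  have gf x : exists y, g x == f y.
    have [e eE xe] := cov x.
    have /imsetP[e' _ ee'] : g @: e \in edge_image E f.
      by rewrite -gE; apply: imset_f.
    have : g x \in g @: e by apply: imset_f.
    by rewrite ee' => /imsetP[y _ ->]; exists y.
  pose s x := xchoose (gf x).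
  have sE x : g x = f (s x) by apply/eqP; exact: (xchooseP (gf x)).
  have si : injective s by move=> x y sxy; apply: gi; rewrite !sE sxy.
  have gh : g = h (perm si) by apply/ffunP => x; rewrite ffunE permE sE.
  exists (perm si) => //; rewrite inE; apply/forallP => e; apply/eqP.
  by rewrite -(mem_edge_image (f := g)) // gE gh hE mem_edge_image.
rewrite inE => /forallP sA; split.
  apply/injectiveP => x y; rewrite !ffunE => /fi; exact: perm_inj.
(* Both images have [#|E|] edges, so one inclusion suffices. *)
rewrite eqEcard !card_edge_image ?leqnn ?andbT //; last first.
  by move=> x y; rewrite !ffunE => /fi; exact: perm_inj.
apply/fintype.subsetP => _ /imsetP[e eE ->]; rewrite hE.
by apply: imset_f; rewrite -(eqP (sA e)).
Qed.

(** The common part of the two embeddings is pulled back along [g] to a piece of [H], where strict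
    balance can be applied to it. *)
Definition overlap_vertices f g : {set V} := [set x | g x \in f @: [set: V]].
Definition overlap_edges f g : {set {set V}} :=
  [set e in E | g @: e \in edge_image E f].

Definition proper_piece (SF : {set V} * {set {set V}}) : bool :=
  [&& is_subgraph E SF.1 SF.2, (1 <= #|SF.2|)%N & SF != ([set: V], E)].

Definition overlapping f g : bool :=
  (edge_image E g != edge_image E f) && ~~ [disjoint edge_image E g & edge_image E f].

(** A shared edge makes the piece nonempty; a piece with all of [E] would force the two edge images
    to agree, by cardinality. *)
Lemma overlap_proper f g : injective f -> injective g ->
  overlapping f g ->
  proper_piece (overlap_vertices f g, overlap_edges f g).
Proof.
move=> fi gi /andP[ne dis]; apply/and3P; split => /=.
- apply/andP; split; first by apply/fintype.subsetP => e; rewrite inE => /andP[].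
  apply/forallP => e; apply/implyP; rewrite inE => /andP[_ /imsetP[e' _ ee']].
  apply/fintype.subsetP => x xe; rewrite inE.
  have : g x \in g @: e by apply: imset_f.
  by rewrite ee' => /imsetP[y _ ->]; apply: imset_f.
- move: dis; rewrite -setI_eq0 => /set0Pn[_ /setIP[/imsetP[e eE ->] fe]].
  by apply/card_gt0P; exists e; rewrite inE eE.
apply: contraNneq ne => -[_ FE]; rewrite eqEcard !card_edge_image // leqnn andbT.
apply/fintype.subsetP => _ /imsetP[e eE ->].
by move: eE; rewrite -{1}FE inE => /andP[].
Qed.

Lemma card_edge_imageD f g : injective g ->
  #|edge_image E g :\: edge_image E f| = (#|E| - #|overlap_edges f g|)%N.
Proof.
move=> gi.
have -> : edge_image E g :\: edge_image E f
    = [set g @: (e : {set V}) | e : {set V} in E :\: overlap_edges f g].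
  apply/setP => y; apply/setDP/imsetP => [[/imsetP[e eE ->] ne]|[e]].
    by exists e => //; rewrite !inE eE /= andbT.
  rewrite !inE => /andP[+ eE] ->; rewrite eE /= => ne.
  by split => //; apply: imset_f.
rewrite card_imset; last exact: imset_injective.
rewrite cardsD; congr (_ - _)%N; apply: eq_card => e.
by rewrite !inE andbA andbb.
Qed.

(** A vertex of [S] must land in the range of [f], which has at most [#|V|] points; any other vertex
    has at most [m] choices. *)
Lemma card_overlap_le f (S : {set V}) :
  (#|[set g : {ffun V -> 'I_m} | overlap_vertices f g == S]|
   <= #|V| ^ #|S| * m ^ (#|V| - #|S|))%N.
Proof.
pose Q x : pred 'I_m := fun j => (x \in S) ==> (j \in f @: [set: V]).
apply: (@leq_trans (\sum_(g in family Q) \prod_(x : V) 1)%N).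
  rewrite (eq_bigr (fun=> 1%N)); last by move=> g _; rewrite big1.
  rewrite sum1_card; apply: subset_leq_card; apply/fintype.subsetP => g.
  rewrite inE => /eqP gS; apply/familyP => x.
  by rewrite unfold_in /Q -gS inE implybb.
rewrite -(bigA_distr_big_dep Q (fun _ _ => 1%N)).
rewrite (bigID (mem S)) /=; apply: leq_mul.
  rewrite -prod_nat_const; apply: leq_prod => x xS.
  rewrite sum1dep_card; apply: (@leq_trans #|f @: [set: V]|); last first.
    by rewrite (leq_trans (leq_imset_card _ _)) ?cardsT.
  by apply: subset_leq_card; apply/fintype.subsetP => j; rewrite !inE /Q xS.
have -> : (#|V| - #|S| = #|~: S|)%N by rewrite -(cardsC S) addKn.
rewrite -prod_nat_const (eq_bigl (fun x => x \in ~: S)); last by move=> x; rewrite inE.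
apply: leq_prod => x _; rewrite sum1dep_card.
by rewrite (leq_trans (max_card _)) ?card_ord.
Qed.

(** The left side is the expected number of overlapping embeddings completed once [f] is planted.
    They are grouped by the piece of [H] shared with [f]; only the edges outside it must still be
    present. *)
Lemma sum_overlap_le (R : realType) (p : R) f : 0 <= p -> injective f ->
  \sum_(g : {ffun V -> 'I_m} | injectiveb g && overlapping f g)
     p ^+ #|edge_image E g :\: edge_image E f|
  <= \sum_(SF | proper_piece SF)
       #|V|%:R ^+ #|SF.1| * m%:R ^+ (#|V| - #|SF.1|) * p ^+ (#|E| - #|SF.2|).
Proof.
move=> p0 fi.
rewrite (partition_big (fun g => (overlap_vertices f g, overlap_edges f g))
  proper_piece); last by move=> g /andP[/injectiveP gi]; exact: overlap_proper.
apply: ler_sum => -[S F] _ /=.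
apply: (@le_trans _ _ (\sum_(g in [set g | overlap_vertices f g == S]) p ^+ (#|E| - #|F|))).
  rewrite [leRHS](bigID (fun g => (injectiveb g && overlapping f g)
                                  && (overlap_edges f g == F))) /=.
  rewrite -[leLHS]addr0; apply: lerD; last by apply: sumr_ge0 => *; exact: exprn_ge0.
  rewrite le_eqVlt; apply/orP; left; apply/eqP.
  apply: eq_big => [g|g /andP[/andP[/injectiveP gi _] /eqP[_ FE]]].
    by rewrite inE xpair_eqE; case: (_ == S); rewrite ?andbF /=.
  by rewrite card_edge_imageD // FE.
rewrite sumr_const -[leLHS]mulr_natl; apply: ler_wpM2r; first exact: exprn_ge0.
by rewrite -!natrX -natrM ler_nat card_overlap_le.
Qed.

End EdgeImage.

(** * The approximate Stein-Chen identity *)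

Definition mean_copies (R : realType) (V : finType) (E : {set {set V}}) (m : nat)
    (p : R) : R := (m ^_ #|V|)%:R * p ^+ #|E| / (autH E)%:R.

Definition overlap_sum (R : realType) (V : finType) (E : {set {set V}}) (m : nat)
    (p : R) : R :=
  \sum_(SF | proper_piece E SF)
     #|V|%:R ^+ #|SF.1| * m%:R ^+ (#|V| - #|SF.1|) * p ^+ (#|E| - #|SF.2|).

(** The first term accounts for the planted copy being present already, the second for new copies
    that use some of the planted edges; the prefactor sums over the possible plantings. *)
Definition stein_error (R : realType) (V : finType) (E : {set {set V}}) (m : nat)
    (p : R) : R :=
  mean_copies E m p * (p ^+ #|E| + overlap_sum E m p / (autH E)%:R).

Section Stein.
Context (R : realType) (V : finType) (E : {set {set V}}) (m : nat) (p : R).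
Hypotheses (gE : is_graph E) (cov : forall x : V, exists2 e, e \in E & x \in e).
Hypothesis p01 : 0 <= p <= 1.
Local Notation a := ((autH E)%:R : R).
Local Notation T := (@copies R V E m).
Implicit Types f g : {ffun V -> 'I_m}.

Lemma autH_gt0 : 0 < a.
Proof.
rewrite ltr0n; apply/card_gt0P; exists 1%g; rewrite inE; apply/forallP => e.
rewrite (_ : _ @: e = e) //; apply/setP => x.
by rewrite -{1}(perm1 x) mem_imset //; exact: perm_inj.
Qed.

Lemma copies_ge0 G : 0 <= T G.
Proof. by rewrite /copies divr_ge0. Qed.

(** Embeddings are compared one by one. Those with the planted image add the expected 1 unless that
    image was already in [G]; overlapping ones gain at most the indicator that their missing edges
    are in [G]; edge-disjoint ones gain nothing. *)
Lemma copies_increment_le f G : injective f ->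
  `|T (edge_image E f :|: G) - (T G + 1)|
  <= a^-1 * (\sum_(g : {ffun V -> 'I_m} | injectiveb g && (edge_image E g == edge_image E f))
               (edge_image E g \subset G)%:R
           + \sum_(g : {ffun V -> 'I_m} | injectiveb g && overlapping E f g)
               (edge_image E g :\: edge_image E f \subset G)%:R).
Proof.
move=> fi; have a0 := autH_gt0.
(* The 1 in [T G + 1] is spread over the embeddings with the planted image, so that all three terms
   are sums over [g]. *)
have aE : a = \sum_(g : {ffun V -> 'I_m} | injectiveb g)
                 (edge_image E g == edge_image E f)%:R.
  rewrite -(card_same_edge_image cov fi) -sum1dep_card natr_sum big_mkcondr /=.
  by apply: eq_bigr => g _; case: eqP.
have -> : T (edge_image E f :|: G) - (T G + 1)
   = a^-1 * (\sum_(g : {ffun V -> 'I_m} | injectiveb g)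
       ((edge_image E g \subset edge_image E f :|: G)%:R
        - (edge_image E g \subset G)%:R - (edge_image E g == edge_image E f)%:R)).
  rewrite !sumrB -aE -!injHGE /copies; field.
  by rewrite gt_eqF.
rewrite normrM gtr0_norm ?invr_gt0 // ler_pM2l ?invr_gt0 //.
rewrite !big_mkcondr -big_split /=.
apply: le_trans (ler_norm_sum _ _ _) _; apply: ler_sum => g _.
rewrite /overlapping; have [->|ne] /= := eqVneq (edge_image E g) (edge_image E f).
  rewrite finset.subsetUl addr0; case: (_ \subset G);
    by rewrite !(subr0, subrr, sub0r, normrN, normr1, normr0).
rewrite subr0 add0r -subDset.
case: ifPn => [_|].
  have [gG|gG] := boolP (edge_image E g \subset G).
    by rewrite (fintype.subset_trans (finset.subsetDl _ _)) // subrr normr0.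
  by rewrite subr0 ger0_norm.
rewrite negbK => /setDidPl ->.
by rewrite subrr normr0.
Qed.

(** Linearity over embeddings, then planting: weighting by [T] amounts to summing over all places
    where a copy can be planted. *)
Lemma expect_copiesM (phi : {set {set 'I_m}} -> R) :
  expect p (fun G => T G * phi G) =
  \sum_(f : {ffun V -> 'I_m} | injectiveb f)
     p ^+ #|E| / a * expect p (fun G => phi (edge_image E f :|: G)).
Proof.
transitivity (expect p (fun G => \sum_(f : {ffun V -> 'I_m} | injectiveb f)
   a^-1 * ((edge_image E f \subset G)%:R * phi G))).
  apply: eq_expect => G; rewrite -big_distrr -big_distrl /= -injHGE /copies.
  by rewrite mulrCA mulrA.
rewrite expect_sum; apply: eq_bigr => f /injectiveP fi.
rewrite expectZ expect_sub ?is_graph_edge_image // card_edge_image //.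
by rewrite mulrCA mulrA.
Qed.

Lemma sum_injective (k : R) :
  \sum_(f : {ffun V -> 'I_m} | injectiveb f) k = (m ^_ #|V|)%:R * k.
Proof.
rewrite sumr_const mulr_natl; congr (_ *+ _).
by rewrite -[X in (X ^_ _)%N](card_ord m) -card_inj_ffuns; apply: eq_card => f; rewrite !inE.
Qed.

Lemma expect_copies : expect p T = mean_copies E m p.
Proof.
transitivity (expect p (fun G => T G * 1)).
  by apply: eq_expect => G; rewrite mulr1.
rewrite (expect_copiesM (fun=> 1)) /mean_copies -[RHS]mulrA -sum_injective.
by apply: eq_bigr => f _; rewrite expect_cst mulr1.
Qed.

(** After planting at [f], the argument of [g] is compared with [T G + 1]. The Lipschitz bound
    reduces this to the expected increment error, which is bounded uniformly in [f]. *)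
Lemma stein_copies (g : R -> R) (L : R) : 0 <= L ->
  (forall x y, 0 <= x -> 0 <= y -> `|g x - g y| <= L * `|x - y|) ->
  `|expect p (fun G => T G * g (T G))
    - mean_copies E m p * expect p (fun G => g (T G + 1))|
  <= L * stein_error E m p.
Proof.
case/andP: (p01) => p0 p1 L0 gL; have a0 := autH_gt0.
have q0 : 0 <= p ^+ #|E| / a by rewrite divr_ge0 ?exprn_ge0 // ltW.
have meanE (k : R) : mean_copies E m p * k
    = \sum_(f : {ffun V -> 'I_m} | injectiveb f) p ^+ #|E| / a * k.
  by rewrite sum_injective /mean_copies !mulrA.
rewrite (expect_copiesM (fun G => g (T G))) /stein_error !meanE -sumrB [leRHS]big_distrr /=.
apply: le_trans (ler_norm_sum _ _ _) _; apply: ler_sum => f /injectiveP fi.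
rewrite -mulrBr -expectB normrM (ger0_norm q0) mulrCA.
apply: ler_wpM2l => //; apply: le_trans (ler_norm_expect _ p01) _.
pose D (G : {set {set 'I_m}}) : R :=
  \sum_(g : {ffun V -> 'I_m} | injectiveb g && (edge_image E g == edge_image E f))
               (edge_image E g \subset G)%:R
           + \sum_(g : {ffun V -> 'I_m} | injectiveb g && overlapping E f g)
               (edge_image E g :\: edge_image E f \subset G)%:R.
apply: (@le_trans _ _ (expect p (fun G => L * (a^-1 * D G)))).
  apply: ler_expect => // G; apply: le_trans (gL _ _ _ _) _; rewrite ?addr_ge0 ?copies_ge0 //.
  by rewrite ler_wpM2l // copies_increment_le.
rewrite !expectZ ler_wpM2l // expectD !expect_sum mulrDr; apply: lerD.
  (* There are [autH E] embeddings with the planted image, each present with probability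
     [p ^+ #|E|]; the factor [a^-1] cancels their number. *)
  rewrite (eq_bigr (fun=> p ^+ #|E|)); last first.
    move=> h /andP[/injectiveP hi _].
    by rewrite prob_sub ?is_graph_edge_image // card_edge_image.
  rewrite sumr_const -[X in _ * X]mulr_natl.
  have -> : #|[pred h : {ffun V -> 'I_m} | injectiveb h & edge_image E h == edge_image E f]|
       = autH E.
    by rewrite -(card_same_edge_image cov fi); apply: eq_card => h; rewrite !inE.
  by rewrite mulrA mulVf ?mul1r // gt_eqF.
rewrite mulrC ler_wpM2r ?invr_ge0 ?(ltW a0) //.
apply: le_trans (sum_overlap_le E p0 fi); apply: ler_sum => h /andP[/injectiveP hi _].
rewrite prob_sub //; apply/is_graphP => e /setDP[eh _].
by move/is_graphP: (is_graph_edge_image gE hi); apply.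
Qed.

End Stein.

(** * Asymptotics under strict balance *)

(** Deleting an isolated vertex would keep all the edges on fewer vertices, giving a proper subgraph
    that is at least as dense. *)
Lemma strictly_balanced_cover (V : finType) (E : {set {set V}}) :
  is_graph E -> (0 < #|E|)%N -> strictly_balanced E ->
  forall x : V, exists2 e, e \in E & x \in e.
Proof.
move=> /is_graphP gE E0 sb x.
have [/existsP[e /andP[]]|/existsPn nx] := boolP [exists e, (e \in E) && (x \in e)].
  by exists e.
have Ex e : e \in E -> e \subset [set~ x].
  move=> eE; apply/fintype.subsetP => y ye; rewrite !inE.
  by apply: contraTneq ye => ->; have := nx e; rewrite eE.
have S1 : is_subgraph E [set~ x] E.
  by rewrite /is_subgraph fintype.subxx; apply/forallP => e; apply/implyP => /Ex.
have ne : ([set~ x], E) != ([set: V], E).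
  by apply/eqP => -[] /setP /(_ x); rewrite !inE eqxx.
have := sb _ _ S1 E0 ne; rewrite cardsC1 /density ltNge; case/negP.
have [e eE] : exists e, e \in E by apply/card_gt0P.
(* An edge avoiding [x] leaves at least two vertices, so the smaller density has a nonzero
   denominator. *)
have := subset_leq_card (Ex e eE); rewrite cardsC1 gE // => v1.
rewrite ler_wpM2l // lef_pV2 ?posrE ?ltr0n ?ler_nat; lia.
Qed.

Lemma kHE (V : finType) (E : {set {set V}}) : (0 < #|E|)%N ->
  is_graph E -> strictly_balanced E -> kH E = density #|V| #|E|.
Proof.
move=> E0 gE sb; apply/le_anti/andP; split; rewrite /kH.
  apply: bigmax_le => [|[S F] /andP[SF F0]]; first by rewrite /density divr_ge0.
  have [[-> ->]|ne] := eqVneq (S, F) ([set: V], E); first by rewrite cardsT.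
  exact: ltW (sb _ _ SF F0 ne).
have := @le_bigmax_cond _ _ _ 0 ([set: V], E)
  (fun SF => is_subgraph E SF.1 SF.2 && (1 <= #|SF.2|)%N)
  (fun SF => density #|SF.1| #|SF.2|).
rewrite /= cardsT; apply.
rewrite /is_subgraph fintype.subxx E0 andbT /=.
by apply/forallP => e; apply/implyP => _; exact: finset.subsetT.
Qed.

Local Open Scope classical_set_scope.
Local Open Scope ring_scope.

Lemma near_infty_gt0 : \forall m \near \oo, (0 < m)%N.
Proof. by exists 1%N. Qed.

Lemma cvg_inv_nat (R : realType) (c : R) : c / m%:R @[m --> \oo] --> 0.
Proof.
rewrite -[X in _ --> X](mulr0 c); apply: cvgM; first exact: cvg_cst.
apply/gtr0_cvgV0; last exact: cvgr_idn.
by near do rewrite ltr0n; exact: near_infty_gt0.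
Unshelve. all: by end_near. Qed.

Lemma powR_inv_nat_cvg0 (R : realType) (c b : R) : 0 < c -> 0 < b ->
  (c / m%:R) `^ b @[m --> \oo] --> 0.
Proof.
move=> c0 b0; apply: (cvg_comp (fun m : nat => c / m%:R) (fun x => x `^ b) _ (powR_cvg0 b0)).
move=> A A0; have := cvg_inv_nat c A0; apply: filterS2 near_infty_gt0 => m m0.
by apply; rewrite divr_gt0 // ltr0n.
Qed.

Lemma ffact_div_cvg1 (R : realType) (k : nat) :
  (m ^_ k)%:R / m%:R ^+ k @[m --> \oo] --> (1 : R).
Proof.
elim: k => [|k IH].
  under eq_fun do rewrite ffactn0 expr0 divr1; exact: cvg_cst.
rewrite -[X in _ --> X]mulr1.
apply: cvg_trans (cvgM IH (_ : (m - k)%N%:R / m%:R @[m --> \oo] --> (1 : R))).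
  apply: near_eq_cvg; near=> m.
  by rewrite /= ffactnSr exprSr natrM invfM mulrACA.
have : 1 - k%:R / m%:R @[m --> \oo] --> (1 - 0 : R).
  by apply: cvgB; [exact: cvg_cst|exact: cvg_inv_nat].
rewrite subr0; apply: cvg_trans; apply: near_eq_cvg; near=> m.
have m0 : (0 < m)%N by near: m; exact: near_infty_gt0.
rewrite natrB; last by near: m; exact: nbhs_infty_ge.
by field; rewrite pnatr_eq0 -lt0n.
Unshelve. all: by end_near. Qed.

Section Asymptotics.
Context (R : realType) (V : finType) (E : {set {set V}}) (c : R).
Hypotheses (gE : is_graph E) (E0 : (0 < #|E|)%N) (sb : strictly_balanced E).
Hypothesis c0 : 0 < c.
Local Notation v := #|V|.
Local Notation e := #|E|.
Local Notation p := (fun m : nat => (c / m%:R) `^ (ratr (kH E))^-1).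

Let V0 : (0 < v)%N.
Proof.
have /card_gt0P[f fE] := E0.
by rewrite (leq_trans _ (max_card (mem f))) // (is_graphP _ gE _ fE).
Qed.

Lemma kH_inv : (ratr (kH E))^-1 = v%:R / e%:R :> R.
Proof. by rewrite kHE // /density fmorph_div !rmorph_nat invf_div. Qed.

Lemma edge_probX (m k : nat) : p m ^+ k = (c / m%:R) `^ (v%:R / e%:R * k%:R).
Proof. by rewrite powRrM powR_mulrn ?powR_ge0 // kH_inv. Qed.

(** This is the purpose of the exponent [1 / k(H)]: it makes [m ^ v * p ^ e] equal to [c ^ v], so
    the mean number of copies stays of order one. *)
Lemma edge_probXe m : p m ^+ e = (c / m%:R) ^+ v.
Proof.
rewrite edge_probX divfK ?powR_mulrn // ?divr_ge0 // ?(ltW c0) //.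
by rewrite pnatr_eq0 -lt0n.
Qed.

Lemma near_edge_prob01 : \forall m \near \oo, 0 <= p m <= 1.
Proof.
have : \forall m \near \oo, `|c / m%:R| < 1.
  by apply: cvgr0_norm_lt => //; exact: cvg_inv_nat.
apply: filterS => m.
have cm0 : 0 <= c / m%:R by rewrite divr_ge0 // ltW.
rewrite ger0_norm // => cm1; rewrite powR_ge0 /=.
apply: (@le_trans _ _ (1 `^ (ratr (kH E))^-1)); last by rewrite powR1.
by apply: ge0_ler_powR; rewrite ?nnegrE ?(ltW cm1) // kH_inv divr_ge0.
Qed.

Lemma mean_copiesE m : (0 < m)%N ->
  mean_copies E m (p m) = (m ^_ v)%:R / m%:R ^+ v * (c ^+ v / (autH E)%:R).
Proof.
move=> m0; rewrite /mean_copies edge_probXe expr_div_n; field.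
by rewrite gt_eqF ?autH_gt0 // expf_neq0 // pnatr_eq0 -lt0n.
Qed.

Lemma mean_copies_cvg :
  mean_copies E m (p m) @[m --> \oo] --> c ^+ v / (autH E)%:R.
Proof.
have : (m ^_ v)%:R / m%:R ^+ v * (c ^+ v / (autH E)%:R) @[m --> \oo]
    --> 1 * (c ^+ v / (autH E)%:R).
  by apply: cvgM; [exact: ffact_div_cvg1|exact: cvg_cst].
rewrite mul1r; apply: cvg_trans; apply: near_eq_cvg; near=> m; rewrite /= mean_copiesE //.
by near: m; exact: near_infty_gt0.
Unshelve. all: by end_near. Qed.

Lemma mean_copies_le m : (0 < m)%N ->
  mean_copies E m (p m) <= c ^+ v / (autH E)%:R.
Proof.
move=> m0; rewrite mean_copiesE // ler_piMl ?divr_ge0 ?exprn_ge0 ?(ltW c0) //.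
rewrite ler_pdivrMr ?mul1r ?exprn_gt0 ?ltr0n // -natrX ler_nat.
rewrite ffact_prod -[X in (_ <= _ ^ X)%N](card_ord v) -prod_nat_const.
by apply: leq_prod => i _; exact: leq_subr.
Qed.

(** A piece with [s] vertices and [j] edges contributes a constant times [(c / m)] to the power
    [s - v * j / e], and strict balance makes this exponent positive. *)
Lemma overlap_sum_cvg0 : overlap_sum E m (p m) @[m --> \oo] --> 0.
Proof.
rewrite /overlap_sum.
have {2}-> : 0 = \sum_(SF | proper_piece E SF) (0 : R) by rewrite big1.
apply: cvg_big; first exact: add_continuous.
move=> [S F] /and3P[/= SF F0 ne].
pose s := #|S|; pose j := #|F|.
(* This is [j / s < e / v] cleared of denominators. *)
have b0 : 0 < s%:R - v%:R / e%:R * j%:R :> R.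
  have s0 : (0 < s)%N.
    have /card_gt0P[f fF] := F0; case/andP: SF => /fintype.subsetP FE /forallP /(_ f).
    by rewrite fF => /subset_leq_card; rewrite (is_graphP _ gE _ (FE _ fF)) => /ltnW.
  have := sb SF F0 ne; rewrite /density ltr_pdivrMr ?ltr0n // mulrAC.
  rewrite ltr_pdivlMr ?ltr0n // -!natrM ltr_nat => jv.
  by rewrite subr_gt0 mulrAC ltr_pdivrMr ?ltr0n // -!natrM ltr_nat mulnC [(s * _)%N]mulnC.
have : v%:R ^+ s * c ^+ (v - s) * (c / m%:R) `^ (s%:R - v%:R / e%:R * j%:R) @[m --> \oo]
    --> v%:R ^+ s * c ^+ (v - s) * 0.
  by apply: cvgM; [exact: cvg_cst|exact: powR_inv_nat_cvg0].
rewrite mulr0; apply: cvg_trans; apply: near_eq_cvg; near=> m.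
have m0 : (0 < m)%N by near: m; exact: near_infty_gt0.
have mN : m%:R != 0 :> R by rewrite pnatr_eq0 -lt0n.
have x0 : 0 < c / m%:R by rewrite divr_gt0 ?ltr0n.
have jE : (j <= e)%N by case/andP: SF => /subset_leq_card.
have sV : (s <= v)%N by exact: max_card.
rewrite edge_probX -/s -/j natrB //.
(* The exponent is split so that its integer part [v - s] cancels the factor [m%:R ^+ (v - s)]. *)
have -> : v%:R / e%:R * (e%:R - j%:R) = s%:R - v%:R / e%:R * j%:R + (v - s)%:R :> R.
  by rewrite natrB //; field; rewrite pnatr_eq0 -lt0n.
rewrite [X in _ = _ * X]powRD; last by rewrite (gt_eqF x0) implybT.
rewrite (powR_mulrn _ (ltW x0)) expr_div_n -/s.
have : m%:R ^+ (v - s) != 0 :> R by rewrite expf_neq0.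
by move: (m%:R ^+ (v - s)) (c ^+ (v - s)) (v%:R ^+ s) => M C W MN; field.
Unshelve. all: by end_near. Qed.

Lemma stein_error_cvg0 : stein_error E m (p m) @[m --> \oo] --> 0.
Proof.
rewrite -(mulr0 (c ^+ v / (autH E)%:R)); apply: cvgM; first exact: mean_copies_cvg.
rewrite -[X in _ --> X](addr0 0); apply: cvgD.
  rewrite (_ : (fun _ => _) = (fun m : nat => (c / m%:R) `^ v%:R)).
    by apply: powR_inv_nat_cvg0; rewrite ?ltr0n.
  by apply/funext => m; rewrite edge_probXe powR_mulrn // divr_ge0 // ltW.
rewrite -(mul0r (autH E)%:R^-1); apply: cvgM; first exact: overlap_sum_cvg0.
exact: cvg_cst.
Qed.

End Asymptotics.

(** * Independent samples and the estimating function *)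

Section IidGnp.
Context (R : realType) (n m : nat) (p : R).
Hypothesis p01 : 0 <= p <= 1.
Local Notation graphs := {ffun 'I_n -> {set {set 'I_m}}}.
Local Notation wt := (fun w : graphs => \prod_(i < n) gnp_mass p (w i)).

Lemma iid_prod (F : 'I_n -> {set {set 'I_m}} -> R) :
  \sum_(w : graphs) wt w * \prod_(i < n) F i (w i) = \prod_(i < n) expect p (F i).
Proof.
by rewrite bigA_distr_bigA; apply: eq_bigr => w _; rewrite big_split.
Qed.

Lemma wt_ge0 w : 0 <= wt w.
Proof. by apply: prodr_ge0 => i _; exact: gnp_mass_ge0. Qed.

Lemma sum_wt : \sum_(w : graphs) wt w = 1.
Proof.
have := iid_prod (fun _ _ => 1); rewrite [RHS]big1; last by move=> i _; exact: expect_cst.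
by move=> s1; rewrite -[RHS]s1; apply: eq_bigr => w _; rewrite [X in _ * X]big1 ?mulr1.
Qed.

Lemma iid_prob_le1 (A : graphs -> Prop) : iid_gnp_prob p A <= 1.
Proof.
rewrite -sum_wt /iid_gnp_prob big_mkcond; apply: ler_sum => w _.
by case: ifP => // _; exact: wt_ge0.
Qed.

Lemma iid_prob_ge (A B C : graphs -> Prop) : (forall w, B w \/ C w \/ A w) ->
  1 - iid_gnp_prob p B - iid_gnp_prob p C <= iid_gnp_prob p A.
Proof.
move=> ABC; rewrite !lerBlDr -sum_wt /iid_gnp_prob -addrA.
rewrite !(big_mkcond (fun w => `[< _ >])) -!big_split; apply: ler_sum => w _ /=.
have w0 := wt_ge0 w.
have [|nB] := asboolP (B w); have [|nC] := asboolP (C w); have [|nA] := asboolP (A w);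
  try by [lra|case: (ABC w) => [|[]]].

Qed.

Lemma iid_prob_le (A : graphs -> Prop) (Phi : graphs -> R) :
  (forall w, 0 <= Phi w) -> (forall w, A w -> 1 <= Phi w) ->
  iid_gnp_prob p A <= \sum_w wt w * Phi w.
Proof.
move=> P0 P1; rewrite /iid_gnp_prob big_mkcond; apply: ler_sum => w _.
have w0 := wt_ge0 w.
have [/P1|_] := asboolP (A w); last by rewrite mulr_ge0.
by move=> ?; rewrite ler_peMr.
Qed.

(** Independence and centring make every off-diagonal term vanish. *)
Lemma iid_second_moment (Z : {set {set 'I_m}} -> R) : expect p Z = 0 ->
  \sum_(w : graphs) wt w * (\sum_(i < n) Z (w i)) ^+ 2
  = n%:R * expect p (fun G => Z G ^+ 2).
Proof.
move=> Z0.
(* Padding with factors 1 gives a product over all coordinates, which [iid_prod] can integrate; the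
   form also covers [i = j]. *)
have prodE (i j : 'I_n) (w : graphs) : Z (w i) * Z (w j) =
    \prod_(k < n) ((if k == i then Z (w k) else 1) * (if k == j then Z (w k) else 1)).
  by rewrite big_split -!big_mkcond !big_pred1_eq.
transitivity (\sum_(i < n) \sum_(j < n) \prod_(k < n) expect p (fun G =>
   (if k == i then Z G else 1) * (if k == j then Z G else 1))).
  rewrite (eq_bigr (fun w : graphs => \sum_(i < n) \sum_(j < n) wt w * (Z (w i) * Z (w j)))).
    rewrite exchange_big; apply: eq_bigr => i _ /=.
    rewrite exchange_big; apply: eq_bigr => j _ /=.
    rewrite -iid_prod; apply: eq_bigr => w _.
    by rewrite prodE.
  move=> w _; rewrite expr2 big_distrl big_distrr /=; apply: eq_bigr => i _.
  by rewrite big_distrr big_distrr.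
transitivity (\sum_(i < n) expect p (fun G => Z G ^+ 2)).
  apply: eq_bigr => i _; rewrite (bigD1 i) //= [X in _ + X]big1 ?addr0.
    rewrite (bigD1 i) //= [X in _ * X]big1 ?mulr1.
      by apply: eq_expect => G; rewrite eqxx expr2.
    move=> k /negbTE ki; rewrite ki -[RHS](expect_cst m p 1).
    by apply: eq_expect => G; rewrite mulr1.
  move=> j ji; rewrite (bigD1 i) //= eqxx [i == j]eq_sym (negbTE ji).
  by rewrite (_ : expect p _ = 0) ?mul0r // -Z0; apply: eq_expect => G; rewrite mulr1.
by rewrite sumr_const card_ord mulr_natl.
Qed.

Lemma iid_chebyshev (Y : {set {set 'I_m}} -> R) (d C : R) : (0 < n)%N -> 0 < d ->
  d <= expect p Y -> expect p (fun G => Y G ^+ 2) <= C ->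
  iid_gnp_prob p (fun w : graphs => \sum_(i < n) Y (w i) <= 0) <= C / d ^+ 2 / n%:R.
Proof.
move=> n0 d0 dY YC; set th := expect p Y in dY.
have th0 : 0 < th by exact: lt_le_trans dY.
have nR : 0 < n%:R :> R by rewrite ltr0n.
pose Z G := Y G - th.
have Z0 : expect p Z = 0 by rewrite expectB expect_cst subrr.
have ZC : expect p (fun G => Z G ^+ 2) <= C.
  rewrite (_ : expect p _ = expect p (fun G => Y G ^+ 2) - 2 * th * th + th ^+ 2).
    have := sqr_ge0 th; nra.
  rewrite -[in X in _ - X]expectZ -expectB -(expect_cst m p (th ^+ 2)) -expectD.
  by apply: eq_expect => G; rewrite /Z; ring.
(* If the sum of the [Y] is at most 0, the centred sum is at most [- n * th], so its square is at
   least [(n * th) ^+ 2]. *)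
apply: (@le_trans _ _ (\sum_(w : graphs) wt w * ((n%:R * th) ^- 2 * (\sum_(i < n) Z (w i)) ^+ 2))).
  apply: iid_prob_le => w; first by rewrite mulr_ge0 ?sqr_ge0 // invr_ge0 sqr_ge0.
  move=> Yw; rewrite mulrC ler_pdivlMr ?exprn_gt0 ?mulr_gt0 // mul1r.
  rewrite /Z sumrB sumr_const card_ord -[th *+ n]mulr_natl.
  have := mulr_gt0 nR th0; move: (n%:R * th) Yw => a; nra.
under eq_bigr do rewrite mulrCA.
rewrite -big_distrr /= iid_second_moment // exprMn invfM.
rewrite (_ : _ * _ = expect p (fun G => Z G ^+ 2) / th ^+ 2 / n%:R); last first.
  by field; rewrite !gt_eqF.
rewrite ler_pM2r ?invr_gt0 //.
have C0 : 0 <= C.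
  by apply: le_trans ZC; apply: sumr_ge0 => G _; rewrite mulr_ge0 ?sqr_ge0 // gnp_mass_ge0.
apply: ler_pM; rewrite ?invr_ge0 ?sqr_ge0 //.
  by apply: sumr_ge0 => G _; rewrite mulr_ge0 ?sqr_ge0 // gnp_mass_ge0.
by rewrite lef_pV2 ?posrE ?exprn_gt0 // ler_pXn2r // nnegrE ltW.
Qed.

End IidGnp.

(** Each summand is nonincreasing in [lam], whichever sign [h j] has, and strictly decreasing when
    [h j] is nonzero. *)
Lemma est_fun_mono (R : realType) (n : nat) (h : 'I_n -> R) (x y : R) (i : 'I_n) :
  x < y -> h i != 0 -> est_fun h y < est_fun h x.
Proof.
move=> xy hi; rewrite /est_fun (bigD1 i) //= [ltRHS](bigD1 i) //=.
have mono j : h j * expR (- (y * h j)) <= h j * expR (- (x * h j)).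
  have [j0|j0] := leP 0 (h j).
    by rewrite ler_wpM2l // ler_expR lerN2 ler_wpM2r // ltW.
  by rewrite ler_wnM2l ?(ltW j0) // ler_expR lerN2 ler_wnM2r ?(ltW j0) // ltW.
apply: ltr_leD; last by apply: ler_sum.
rewrite lt_neqAle mono andbT; apply/negP => /eqP /(mulfI hi) /expR_inj /oppr_inj /(mulIf hi) yx.
by move: xy; rewrite yx ltxx.
Qed.

Lemma est_fun_root (R : realType) (n : nat) (h : 'I_n -> R) (x y : R) :
  x < y -> 0 < est_fun h x -> est_fun h y < 0 ->
  exists lam, [/\ est_fun h lam = 0, (forall lam', est_fun h lam' = 0 -> lam' = lam)
    & x < lam < y].
Proof.
move=> xy fx fy.
(* Were all [h i] zero, the function would vanish identically, against [fx]. This index gives the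
   strict monotonicity behind uniqueness. *)
have [i hi] : exists i, h i != 0.
  apply/existsP; apply: contraLR fx => /existsPn h0; rewrite -leNgt /est_fun big1 //.
  by move=> j _; move: (h0 j); rewrite negbK => /eqP ->; rewrite mul0r.
have cf : continuous (est_fun h).
  move=> z; apply: cvg_big; first exact: add_continuous.
  move=> j _.
  apply: cvgM; first exact: cvg_cst.
  apply: (cvg_comp _ expR _ (@continuous_expR R _)).
  by apply: cvgN; apply: cvgM; [exact: cvg_id|exact: cvg_cst].
have [|lam /itvP lxy flam] := @IVT R (est_fun h) x y 0 (ltW xy) (continuous_subspaceT cf).
  by rewrite ge_min le_max (ltW fy) (ltW fx) orbT.
exists lam; split => //.
  move=> l fl; apply/eqP; rewrite eq_le !leNgt; apply/andP; split; apply/negP.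
    by move=> /est_fun_mono /(_ hi); rewrite fl flam ltxx.
  by move=> /est_fun_mono /(_ hi); rewrite fl flam ltxx.
rewrite !lt_neqAle !lxy !andbT; apply/andP; split; apply/eqP => E.
  by move: fx; rewrite E flam ltxx.
by move: fy; rewrite -E flam ltxx.
Qed.

(** * The sign of the drift *)

(** For [x <= y] the difference is [exp(-l x) (1 - exp(-l (y - x)))]: the first factor is at most 1,
    the second at most [l (y - x)]. *)
Lemma expRN_lipschitz (R : realType) (l x y : R) : 0 <= l -> 0 <= x -> 0 <= y ->
  `|expR (- (l * x)) - expR (- (l * y))| <= l * `|x - y|.
Proof.
move=> l0; wlog xy : x y / x <= y => [hw x0 y0|x0 y0].
  by have [/hw|/ltW/hw] := leP x y; [|rewrite distrC [`|x - y|]distrC]; apply.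
have lxy : l * x <= l * y by rewrite ler_wpM2l.
rewrite ger0_norm ?subr_ge0 ?ler_expR ?lerN2 // distrC ger0_norm ?subr_ge0 //.
have -> : - (l * y) = - (l * x) + - (l * (y - x)) by ring.
rewrite expRD -[X in X - _]mulr1 -mulrBr.
have ex1 : expR (- (l * x)) <= 1 by rewrite -expR0 ler_expR oppr_le0 mulr_ge0.
have := expR_ge1Dx (- (l * (y - x))).
have : expR (- (l * (y - x))) <= 1.
  by rewrite -expR0 ler_expR oppr_le0 mulr_ge0 // subr_ge0.
have := expR_gt0 (- (l * x)); nra.
Qed.

Section Drift.
Context (R : realType) (V : finType) (E : {set {set V}}) (c h0 : R).
Hypotheses (gE : is_graph E) (E0 : (0 < #|E|)%N) (sb : strictly_balanced E).
Hypotheses (c0 : 0 < c) (h00 : 0 < h0).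
Local Notation mu := (c ^+ #|V| / (autH E)%:R).
Local Notation p := (fun m : nat => (c / m%:R) `^ (ratr (kH E))^-1).
Local Notation T := (@copies R V E _).
Local Notation Ex m phi := (expect (p m) (fun G : {set {set 'I_m}} => phi (T G))).

Let cov := strictly_balanced_cover gE E0 sb.

Let mu0 : 0 < mu.
Proof. by rewrite divr_gt0 ?exprn_gt0 ?autH_gt0. Qed.

(** The lower bound is Jensen's inequality together with the fact that the mean is at most [mu].
    Being independent of [m], it keeps the drift away from 0. *)
Lemma expect_expR_ge (l : R) : 0 <= l -> \forall m \near \oo,
  expR (- (l * mu)) <= Ex m (fun t => expR (- (l * t))) <= 1.
Proof.
move=> l0; near=> m.
have p01 : 0 <= p m <= 1 by near: m; exact: near_edge_prob01.
have m0 : (0 < m)%N by near: m; exact: near_infty_gt0.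
apply/andP; split; last first.
  apply: (@le_trans _ _ (Ex m (fun=> 1))); last by rewrite expect_cst.
  apply: ler_expect => // G.
  by rewrite -expR0 ler_expR oppr_le0 mulr_ge0 ?copies_ge0.
(* The tangent line of [exp(-l t)] at [t = mu]. *)
apply: (@le_trans _ _ (Ex m (fun t => expR (- (l * mu)) * (1 + l * mu - l * t)))).
  rewrite expectZ expectB expect_cst expectZ expect_copies // ler_peMr ?expR_ge0 //.
  have h := mean_copies_le gE E0 sb c0 m0.
  by have := ler_wpM2l l0 h; lra.
apply: ler_expect => // G.
rewrite (_ : - (l * T G) = - (l * mu) + - (l * (T G - mu))); last by ring.
rewrite expRD ler_wpM2l ?expR_ge0 //; apply: le_trans (expR_ge1Dx _); lra.
Unshelve. all: by end_near. Qed.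

Lemma expect_drift (l eta : R) : 0 <= l -> 0 < eta -> \forall m \near \oo,
  `|Ex m (fun t => (t - h0) * expR (- (l * t)))
    - (mu * expR (- l) - h0) * Ex m (fun t => expR (- (l * t)))| <= eta.
Proof.
move=> l0 eta0; near=> m.
have p01 : 0 <= p m <= 1 by near: m; exact: near_edge_prob01.
have g01 : expR (- (l * mu)) <= Ex m (fun t => expR (- (l * t))) <= 1.
  by near: m; exact: expect_expR_ge.
(* The error is multiplied by the Lipschitz constant [l]; the denominator [l + 1] brings the product
   below [eta / 2] and is nonzero even at [l = 0]. The other half of [eta] pays for replacing the
   mean by [mu]. *)
have err : `|stein_error E m (p m)| <= eta / 2 / (l + 1).
  near: m; apply: cvgr0_norm_le; first exact: stein_error_cvg0.
  by rewrite !divr_gt0 // ltr_wpDl.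
have mean : `|mu - mean_copies E m (p m)| <= eta / 2.
  near: m; move/cvgrPdist_le: (mean_copies_cvg gE E0 sb c0); apply.
  by rewrite divr_gt0.
have := stein_copies m gE cov p01 l0 (fun x y => @expRN_lipschitz R l x y l0).
rewrite (_ : expect _ (fun G => expR (- (l * (T G + 1))))
  = expR (- l) * Ex m (fun t => expR (- (l * t)))); last first.
  rewrite -expectZ; apply: eq_expect => G.
  by rewrite -expRD; congr expR; ring.
rewrite (_ : Ex m (fun t => (t - h0) * expR (- (l * t)))
  = Ex m (fun t => t * expR (- (l * t))) - h0 * Ex m (fun t => expR (- (l * t)))); last first.
  by rewrite -expectZ -expectB; apply: eq_expect => G; rewrite mulrBl.
have l1 : expR (- l) <= 1 by rewrite -expR0 ler_expR oppr_le0.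
have l10 := expR_ge0 (- l).
have lerr : l * stein_error E m (p m) <= eta / 2.
  apply: (@le_trans _ _ (l * (eta / 2 / (l + 1)))).
    by rewrite ler_wpM2l // (le_trans (ler_norm _)).
  rewrite mulrCA ler_piMr ?divr_ge0 ?(ltW eta0) // ler_pdivrMr ?mul1r; lra.
have [g0 g1] : 0 <= Ex m (fun t => expR (- (l * t))) /\ Ex m (fun t => expR (- (l * t))) <= 1.
  by case/andP: g01 => g0 ->; rewrite (le_trans _ g0) ?expR_ge0.
move: (Ex m (fun t => expR (- (l * t)))) g0 g1 => g g0 g1.
move: (Ex m (fun t => t * expR (- (l * t)))) => tg.
move: (mean_copies E m (p m)) mean => mm mean stein.
have : `|(mu - mm) * (expR (- l) * g)| <= eta / 2.
  rewrite normrM (ger0_norm (mulr_ge0 l10 g0)).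
  apply: le_trans mean; rewrite ler_piMr // mulr_ile1 //.
have {}stein := le_trans stein lerr.
move: stein; rewrite !ler_norml; move: (expR (- l)) => el; lra.
Unshelve. all: by end_near. Qed.

Lemma expect_drift_lt0 (l : R) : 0 <= l -> mu * expR (- l) < h0 ->
  exists2 d, 0 < d & \forall m \near \oo,
    Ex m (fun t => (t - h0) * expR (- (l * t))) <= - d.
Proof.
move=> l0 lt; have a0 : 0 < h0 - mu * expR (- l) by rewrite subr_gt0.
(* Half of the limiting drift bound; the other half absorbs the error in [expect_drift]. *)
pose d := (h0 - mu * expR (- l)) * expR (- (l * mu)) / 2.
have d0 : 0 < d by rewrite divr_gt0 // mulr_gt0 // expR_gt0.
exists d => //; near=> m.
have : expR (- (l * mu)) <= Ex m (fun t => expR (- (l * t))) <= 1.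
  by near: m; exact: expect_expR_ge.
have : `|Ex m (fun t => (t - h0) * expR (- (l * t)))
    - (mu * expR (- l) - h0) * Ex m (fun t => expR (- (l * t)))| <= d.
  by near: m; exact: expect_drift.
rewrite ler_norml => /andP[_ le1] /andP[le2 _].
have := ler_wpM2l (ltW a0) le2; rewrite /d in le1 *; lra.
Unshelve. all: by end_near. Qed.

Lemma expect_drift_gt0 (l : R) : 0 <= l -> h0 < mu * expR (- l) ->
  exists2 d, 0 < d & \forall m \near \oo,
    d <= Ex m (fun t => (t - h0) * expR (- (l * t))).
Proof.
move=> l0 lt; have a0 : 0 < mu * expR (- l) - h0 by rewrite subr_gt0.
pose d := (mu * expR (- l) - h0) * expR (- (l * mu)) / 2.
have d0 : 0 < d by rewrite divr_gt0 // mulr_gt0 // expR_gt0.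
exists d => //; near=> m.
have : expR (- (l * mu)) <= Ex m (fun t => expR (- (l * t))) <= 1.
  by near: m; exact: expect_expR_ge.
have : `|Ex m (fun t => (t - h0) * expR (- (l * t)))
    - (mu * expR (- l) - h0) * Ex m (fun t => expR (- (l * t)))| <= d.
  by near: m; exact: expect_drift.
rewrite ler_norml => /andP[le1 _] /andP[le2 _].
have := ler_wpM2l (ltW a0) le2; rewrite /d in le1 *; lra.
Unshelve. all: by end_near. Qed.

(** The Stein-Chen identity for the identity function, with Lipschitz constant 1: the second moment
    is close to [a (a + 1)], where [a <= mu] is the mean. *)
Lemma expect_copies_sqr_le : \forall m \near \oo,
  Ex m (fun t => t ^+ 2) <= mu * (mu + 1) + 1.
Proof.
near=> m.
have p01 : 0 <= p m <= 1 by near: m; exact: near_edge_prob01.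
have m0 : (0 < m)%N by near: m; exact: near_infty_gt0.
have err : `|stein_error E m (p m)| <= 1.
  by near: m; apply: cvgr0_norm_le => //; exact: stein_error_cvg0.
have lip (x y : R) : 0 <= x -> 0 <= y -> `|x - y| <= 1 * `|x - y| by rewrite mul1r.
have := stein_copies m gE cov p01 ler01 lip.
rewrite mul1r expectD expect_cst expect_copies // => st.
have mm := mean_copies_le gE E0 sb c0 m0.
have mm0 : 0 <= mean_copies E m (p m).
  by rewrite /mean_copies divr_ge0 // mulr_ge0 // exprn_ge0 //; case/andP: p01.
rewrite (_ : Ex m (fun t => t ^+ 2) = Ex m (fun t => t * t)); last first.
  by apply: eq_expect => G; rewrite expr2.
have := le_trans (ler_norm _) st; have := le_trans (ler_norm _) err.
move: (Ex m (fun t => t * t)) (mean_copies E m (p m)) mm mm0 => t2 a am a0.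
have := mu0; move: mu am => b; nra.
Unshelve. all: by end_near. Qed.

(** Chebyshev's inequality: the linear growth of [Y] and the second moment of [T] bound that of [Y]
    uniformly in [n], so the probability is of order [1 / n]. *)
Lemma iid_sum_le0_cvg0 (m : nat -> nat) (Y : R -> R) (B d : R) :
  m n @[n --> \oo] --> \oo ->
  0 < d -> (forall t, 0 <= t -> `|Y t| <= B * `|t - h0|) ->
  (\forall m \near \oo, d <= Ex m Y) ->
  iid_gnp_prob (p (m n)) (fun w : {ffun 'I_n -> {set {set 'I_(m n)}}} =>
     \sum_(i < n) Y (T (w i)) <= 0) @[n --> \oo] --> 0.
Proof.
move=> m_oo d0 YB dY.
pose C := B ^+ 2 * (mu * (mu + 1) + 1 + h0 ^+ 2).
have near_m (P : nat -> Prop) : (\forall k \near \oo, P k) -> \forall n \near \oo, P (m n).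
  by move=> /m_oo.
refine (squeeze_cvgr _ (cvg_cst 0) (cvg_inv_nat (C / d ^+ 2))).
near=> n.
have p01 : 0 <= p (m n) <= 1 by near: n; exact: (near_m _ (near_edge_prob01 gE E0 sb c0)).
apply/andP; split.
  by apply: sumr_ge0 => w _; apply: prodr_ge0 => i _; exact: gnp_mass_ge0.
apply: (@iid_chebyshev R n (m n) (p (m n)) p01 (fun G => Y (T G))) => //.
- by near: n; exact: near_infty_gt0.
- by near: n; exact: (near_m _ dY).
apply: (@le_trans _ _ (B ^+ 2 * (Ex (m n) (fun t => t ^+ 2) + h0 ^+ 2))).
  rewrite -[X in _ + X](expect_cst (m n) (p (m n))) -expectD -expectZ.
  apply: ler_expect => // G; have T0 := @copies_ge0 R V E _ G.
  rewrite -real_normK ?num_real //.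
  apply: (@le_trans _ _ ((B * `|T G - h0|) ^+ 2)).
    by rewrite lerXn2r ?nnegrE ?normr_ge0 ?YB // (le_trans _ (YB _ T0)).
  rewrite exprMn ler_wpM2l ?sqr_ge0 // real_normK ?num_real //.
  (* [(T - h0) ^+ 2] is at most [T ^+ 2 + h0 ^+ 2] because [T * h0] is nonnegative. *)
  have := mulr_ge0 T0 (ltW h00); nra.
rewrite ler_wpM2l ?sqr_ge0 // lerD2r.
by near: n; exact: (near_m _ expect_copies_sqr_le).
Unshelve. all: by end_near. Qed.

End Drift.

(** * Comparison functions on the two sides of [lam0] *)

Section Comparison.
Context (R : realType) (V : finType) (E : {set {set V}}) (c h0 : R).
Hypotheses (gE : is_graph E) (E0 : (0 < #|E|)%N) (sb : strictly_balanced E).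
Hypotheses (c0 : 0 < c) (h00 : 0 < h0).
Local Notation mu := (c ^+ #|V| / (autH E)%:R).
Hypothesis h0mu : h0 <= mu.
Local Notation lam0 := (ln (mu / h0)).
Local Notation p := (fun m : nat => (c / m%:R) `^ (ratr (kH E))^-1).
Local Notation T := (@copies R V E _).
Local Notation Ex m phi := (expect (p m) (fun G : {set {set 'I_m}} => phi (T G))).

Lemma expR_lam0 : mu * expR (- lam0) = h0.
Proof.
have mu0 : 0 < mu by exact: lt_le_trans h0mu.
rewrite expRN lnK; last by rewrite posrE; exact: divr_gt0.
by move: mu0; move: mu => b b0; field; rewrite !gt_eqF.
Qed.

Lemma lam0_ge0 : 0 <= lam0.
Proof. by apply: ln_ge0; rewrite ler_pdivlMr // mul1r. Qed.

Lemma weight_split (l t : R) :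
  (t - h0) * expR (- (l * (t - h0))) = expR (l * h0) * ((t - h0) * expR (- (l * t))).
Proof. by rewrite mulrCA -expRD; congr (_ * expR _); ring. Qed.

(** Right of [lam0] the drift is negative, so the summand is negated to have positive mean. Its
    weight is at most [exp(l h0)] since counts are nonnegative. *)
Lemma upper_comparison (e : R) : 0 < e -> exists B d : R,
  [/\ 0 < d,
      forall t, 0 <= t -> `|- ((t - h0) * expR (- ((lam0 + e) * (t - h0))))| <= B * `|t - h0|
    & \forall m \near \oo,
        d <= Ex m (fun t => - ((t - h0) * expR (- ((lam0 + e) * (t - h0)))))].
Proof.
move=> e0; have l0 : 0 <= lam0 + e by rewrite addr_ge0 ?lam0_ge0 // ltW.
have lt : mu * expR (- (lam0 + e)) < h0.
  by rewrite opprD expRD mulrA expR_lam0 gtr_pMr // -expR0 ltr_expR oppr_lt0.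
have [d d0 Hd] := expect_drift_lt0 gE E0 sb c0 l0 lt.
exists (expR ((lam0 + e) * h0)), (expR ((lam0 + e) * h0) * d); split.
- by rewrite mulr_gt0 // expR_gt0.
- move=> t t0; rewrite normrN normrM mulrC ler_wpM2r //.
  by rewrite ger0_norm ?expR_ge0 // ler_expR mulrBr opprB gerBl mulr_ge0.
apply: filterS Hd => m Hm.
rewrite (_ : expect _ _ = - expR ((lam0 + e) * h0) *
  Ex m (fun t => (t - h0) * expR (- ((lam0 + e) * t)))).
  by rewrite mulNr -mulrN ler_wpM2l ?expR_ge0 // lerNr.
by rewrite -expectZ; apply: eq_expect => G; rewrite weight_split mulNr.
Qed.

(** If [e < lam0], the left point is positive, the weight is bounded on nonnegative counts, and [Y]
    is the summand itself. If [lam0 = 0], a smaller function of linear growth takes its place. *)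
Lemma lower_comparison (e : R) : 0 < e -> (lam0 = 0 \/ e < lam0) ->
  exists (Y : R -> R) (B d : R),
  [/\ 0 < d,
      forall t, 0 <= t -> `|Y t| <= B * `|t - h0|,
      forall t, 0 <= t -> Y t <= (t - h0) * expR (- ((lam0 - e) * (t - h0)))
    & \forall m \near \oo, d <= Ex m Y].
Proof.
move=> e0 [lam00|elam]; last first.
  have l0 : 0 <= lam0 - e by rewrite subr_ge0 ltW.
  have lt : h0 < mu * expR (- (lam0 - e)).
    by rewrite opprB addrC expRD mulrA expR_lam0 ltr_pMr // -expR0 ltr_expR.
  have [d d0 Hd] := expect_drift_gt0 gE E0 sb c0 l0 lt.
  exists (fun t => (t - h0) * expR (- ((lam0 - e) * (t - h0)))).
  exists (expR ((lam0 - e) * h0)), (expR ((lam0 - e) * h0) * d); split => //.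
  - by rewrite mulr_gt0 // expR_gt0.
  - move=> t t0; rewrite normrM mulrC ler_wpM2r //.
    by rewrite ger0_norm ?expR_ge0 // ler_expR mulrBr opprB gerBl mulr_ge0.
  apply: filterS Hd => m Hm.
  rewrite (_ : expect _ _ = expR ((lam0 - e) * h0) *
    Ex m (fun t => (t - h0) * expR (- ((lam0 - e) * t)))).
    by rewrite ler_wpM2l ?expR_ge0.
  by rewrite -expectZ; apply: eq_expect => G; rewrite weight_split.
(* Here [mu = h0] and the weight [expR (e * t)] is unbounded.  With [z = expR (e * t)] and
   [z0 = expR (e * h0)], the bounded quantity [z0 + 1 - z0 / z] is at most [z] exactly when
   [(z - z0) * (z - 1) >= 0]: below [z] for [t >= h0] and above it for [0 <= t <= h0], so
   after multiplication by [t - h0] it gives a lower bound in both cases. *)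
have muE : mu = h0 by have := expR_lam0; rewrite lam00 oppr0 expR0 mulr1.
have lt : mu * expR (- e) < h0.
  by rewrite muE gtr_pMr // -expR0 ltr_expR oppr_lt0.
have [d d0 Hd] := expect_drift_lt0 gE E0 sb c0 (ltW e0) lt.
set z0 := expR (e * h0); have z00 : 0 < z0 by exact: expR_gt0.
(* The factor [z0^-1] is the part [exp(-e h0)] of the original weight. *)
exists (fun t => z0^-1 * ((z0 + 1 - z0 * expR (- (e * t))) * (t - h0))).
exists (z0^-1 * (z0 + 1)), (d / 2); split.
- by rewrite divr_gt0.
- move=> t t0; rewrite !normrM -mulrA (gtr0_norm (x := z0^-1)) ?invr_gt0 //.
  rewrite ler_wpM2l ?invr_ge0 ?(ltW z00) // ler_wpM2r //.
  have ez : 0 < expR (- (e * t)) by exact: expR_gt0.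
  have e1 : expR (- (e * t)) <= 1.
    by rewrite -expR0 ler_expR oppr_le0 mulr_ge0 // ltW.
  rewrite ger0_norm; nra.
- move=> t t0; rewrite lam00 sub0r.
  rewrite (_ : - (- e * (t - h0)) = e * t - e * h0); last by ring.
  rewrite expRB -/z0 expRN.
  set z := expR (e * t).
  have z1 : 1 <= z by rewrite -expR0 ler_expR mulr_ge0 // ltW.
  have zp : 0 < z by exact: lt_le_trans z1.
  rewrite -subr_ge0.
  rewrite (_ : _ - _ = (t - h0) * (z - z0) * (z - 1) / (z * z0)); last first.
    by field; rewrite !gt_eqF.
  apply: divr_ge0; last by rewrite mulr_ge0 ?(ltW z00) ?(ltW zp).
  apply: mulr_ge0; last by rewrite subr_ge0.
  have [th|/ltW th] := leP h0 t.
    by rewrite mulr_ge0 ?subr_ge0 // ler_expR ler_wpM2l // ltW.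
  by rewrite mulr_le0 ?subr_le0 // ler_expR ler_wpM2l // ltW.
(* The mean of [Y] has a term proportional to the mean minus [h0], which vanishes in the limit as
   [mu = h0], and a drift term that is at least [d]. This closeness lets the former cost at most
   [d / 2]. *)
have close : \forall m \near \oo, `|mu - mean_copies E m (p m)| <= z0 * d / 2 / (z0 + 1).
  move/cvgrPdist_le: (mean_copies_cvg gE E0 sb c0); apply.
  by rewrite !divr_gt0 ?mulr_gt0 // ltr_wpDl // ltW.
near=> m.
have p01 : 0 <= p m <= 1 by near: m; exact: near_edge_prob01.
rewrite (_ : expect _ _ = z0^-1 * ((z0 + 1) * (mean_copies E m (p m) - h0)
   - z0 * Ex m (fun t => (t - h0) * expR (- (e * t))))); last first.
  rewrite -(expect_copies (E := E)) // -(expect_cst m (p m) h0).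
  rewrite -expectB -!expectZ -expectB -expectZ.
  by apply: eq_expect => G; rewrite expect_cst; ring.
rewrite [leRHS]mulrC ler_pdivlMr //.
have : `|mu - mean_copies E m (p m)| <= z0 * d / 2 / (z0 + 1) by near: m.
rewrite ler_pdivlMr ?ltr_wpDl // ?(ltW z00) // muE => le1.
have : Ex m (fun t => (t - h0) * expR (- (e * t))) <= - d by near: m.
move: (expect _ _) => X XD.
have := ler_wpM2l (ltW z00) XD.
have := ler_wpM2r (ltW (ltr_wpDl (ltW z00) ltr01)) (ler_norm (h0 - mean_copies E m (p m))).
lra.
Unshelve. all: by end_near. Qed.

End Comparison.

(** * Convergence in probability of the root *)

Theorem mainTheorem4 (R : realType) (V : finType) (E : {set {set V}})
  (HG : is_graph E) (Hedge : (1 <= #|E|)%N) (Hsb : strictly_balanced E)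
  (c h0 : R) (Hc : 0 < c) (Hh0 : 0 < h0)
  (Hmu : h0 <= c ^+ #|V| / (autH E)%:R)
  (m : nat -> nat) (Hm : forall M : nat, exists N : nat, forall n : nat,
                          (N <= n)%N -> (M <= m n)%N) :
  let mu := c ^+ #|V| / (autH E)%:R in
  let lam0 := ln (mu / h0) in
  let p := fun n : nat => powR (c / (m n)%:R) (ratr (kH E))^-1 in
  forall eps : R, 0 < eps ->
    (fun n : nat =>
       @iid_gnp_prob R n (m n) (p n) (fun w =>
         let h := fun i : 'I_n => @copies R V E (m n) (w i) - h0 in
         exists lam : R,
           [/\ @est_fun R n h lam = 0,
               (forall lam' : R, @est_fun R n h lam' = 0 -> lam' = lam)
             & `|lam - lam0| < eps]))
    @ \oo --> (1 : R).
Proof.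
move=> mu lam0 p eps eps0.
have m_oo : m n @[n --> \oo] --> \oo.
  move=> P [N _ NP]; have [K HK] := Hm N.
  by exists K => // n /HK /NP.
have lam00 : 0 <= lam0 by exact: lam0_ge0.
(* When [lam0] is positive, the window is shrunk to keep [lam0 - e] positive; a root in the smaller
   window is still within [eps]. *)
have [e [e0 ee el]] : exists e, [/\ 0 < e, e <= eps & lam0 = 0 \/ e < lam0].
  move: lam00; rewrite le_eqVlt => /orP[/eqP l0|l0]; first by exists eps; split => //; left.
  exists (Num.min eps (lam0 / 2)); split.
  - by rewrite lt_min eps0 divr_gt0.
  - by rewrite ge_min lexx.
  - by right; rewrite gt_min ltr_pdivrMr // ltr_pMr // ltr1n orbT.
have [B [d [d0 YB dY]]] := upper_comparison HG Hedge Hsb Hc Hh0 Hmu e0.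
have [Y' [B' [d' [d'0 YB' Y'le dY']]]] := lower_comparison HG Hedge Hsb Hc Hh0 Hmu e0 el.
have PU := iid_sum_le0_cvg0 HG Hedge Hsb Hc Hh0 m_oo d0 YB dY.
have PL := iid_sum_le0_cvg0 HG Hedge Hsb Hc Hh0 m_oo d'0 YB' dY'.
have : 1 - 0 - 0 = 1 :> R by rewrite !subr0.
move=> one; have PLU := cvgB (cvgB (cvg_cst (1 : R)) PL) PU; rewrite one in PLU.
refine (squeeze_cvgr _ (PLU _ _ _) (cvg_cst (1 : R))).
near=> n.
have p01 : 0 <= p n <= 1.
  near: n; have := m_oo _ (near_edge_prob01 HG Hedge Hsb Hc); exact.
apply/andP; split; last exact: iid_prob_le1.
(* The two bad events are a nonpositive sum of the comparison functions at the left or at the right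
   point. Off both, the estimating function changes sign across the window. *)
apply: iid_prob_ge => // w.
have [|lower] := leP (\sum_(i < n) Y' (copies R E (w i))) 0; first by left.
have [|upper] := leP (\sum_(i < n) - ((copies R E (w i) - h0) *
   expR (- ((lam0 + e) * (copies R E (w i) - h0))))) 0; first by right; left.
right; right => /=.
have [|||lam [flam uniq /andP[lam1 lam2]]] :=
    @est_fun_root R n (fun i => copies R E (w i) - h0) (lam0 - e) (lam0 + e).
- lra.
- apply: lt_le_trans lower _; apply: ler_sum => i _.
  by apply: Y'le; exact: copies_ge0.
- by move: upper; rewrite sumrN oppr_gt0.
exists lam; split => //; apply: lt_le_trans ee; rewrite ltr_norml; lra.
Unshelve. all: by end_near. Qed.
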